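(* The lamplighter group $\mathbb{Z}/2\mathbb{Z}\wr\mathbb{Z}$ is not finitely presented as a residually finite group.
   Context: The residually finite image of a group $G$ is the quotient $G/\bigcap_{\phi}\ker(\phi)$, where $\phi$ ranges over all homomorphisms from $G$ onto finite groups. A residually finite finitely generated group $L$ (with a given finite generating tuple $S$) is finitely presented as a residually finite group if there exists a finitely presented group $G$, with a generating tuple, whose residually finite image, marked by the image of that tuple, is isomorphic to $L$ marked by $S$ (via an isomorphism matching the tuples in order). The existence of such a $G$ for $L$ is understood for $L$ with a finite generating tuple. *)

(* Defs.v *)
From HB Require Import structures.
From mathcomp Require Import all_boot all_order all_algebra all_fingroup.
From mathcomp Require Import finmap boolp generic_quotient.

Set Implicit Arguments.
Unset Strict Implicit.
Unset Printing Implicit Defensive.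

Local Open Scope group_scope.
Local Open Scope quotient_scope.

Notation "{ 'ghom' G -> H }" := (UMagmaMorphism.type G H)
  (at level 0, G at level 98, H at level 99,
   format "{ 'ghom'  G  ->  H }") : type_scope.

Definition surjective (T U : Type) (f : T -> U) : Prop :=
  forall u, exists t, f t = u.

Definition isomorphic (G H : groupType) : Prop :=
  exists f : {ghom G -> H}, bijective f.

Definition generates (G : groupType) (n : nat) (S : n.-tuple G) : Prop :=
  forall H : {pred G}, group_closed H -> {subset S <= H} -> forall x, x \in H.

Record normal_subgroup (G : groupType) := NormalSubgroup {
  nsubgroup :> {pred G};
  nsubgroup_closed : group_closed nsubgroup;
  nsubgroup_conjg : forall x y, x \in nsubgroup -> x ^ y \in nsubgroup
}.

Section QuotientGroup.
Variables (G : groupType) (N : normal_subgroup G).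

Definition same_coset (x y : G) : bool := x^-1 * y \in N.

Lemma same_coset_refl : reflexive same_coset.
Proof. by move=> x; rewrite /same_coset mulVg (nsubgroup_closed N).1. Qed.

Lemma same_coset_sym : symmetric same_coset.
Proof.
have sub x y : same_coset x y -> same_coset y x.
  by move=> /(group_closedV (nsubgroup_closed N)); rewrite invgM invgK.
by move=> x y; apply/idP/idP; apply: sub.
Qed.

Lemma same_coset_trans : transitive same_coset.
Proof.
move=> y x z xy yz; have := group_closedM (nsubgroup_closed N) xy yz.
by rewrite mulgA mulgK.
Qed.

Canonical same_coset_equiv :=
  EquivRel same_coset same_coset_refl same_coset_sym same_coset_trans.

Definition quotient_group := {eq_quot same_coset_equiv}.
HB.instance Definition _ := Choice.on quotient_group.
HB.instance Definition _ := EqQuotient.on quotient_group.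

Definition quotient_proj (x : G) : quotient_group := \pi_quotient_group x.

Lemma quotient_projP x y :
  reflect (quotient_proj x = quotient_proj y) (x^-1 * y \in N).
Proof.
by apply: (iffP idP) => [xy|/(eqmodP same_coset_equiv)//];
   apply/(eqmodP same_coset_equiv).
Qed.

Definition quotient_mul (a b : quotient_group) :=
  quotient_proj (repr a * repr b).
Definition quotient_inv (a : quotient_group) := quotient_proj (repr a)^-1.

Lemma repr_proj x : (repr (quotient_proj x))^-1 * x \in N.
Proof. by apply/quotient_projP; rewrite /quotient_proj reprK. Qed.

Lemma quotient_mulE x y :
  quotient_mul (quotient_proj x) (quotient_proj y) = quotient_proj (x * y).
Proof.
apply/quotient_projP; set x' := repr _; set y' := repr _.
have -> : (x' * y')^-1 * (x * y) = (x'^-1 * x) ^ y' * (y'^-1 * y).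
  by rewrite /conjg invgM !mulgA mulgK.
by apply: group_closedM (nsubgroup_closed N) _ _ _ (repr_proj y);
   apply/nsubgroup_conjg/repr_proj.
Qed.

Lemma quotient_invE x : quotient_inv (quotient_proj x) = quotient_proj x^-1.
Proof.
apply/quotient_projP; set x' := repr _.
have -> : (x'^-1)^-1 * x^-1 = ((x'^-1 * x)^-1) ^ x'^-1.
  by rewrite /conjg !invgM !invgK !mulgA mulgK.
apply/nsubgroup_conjg/(group_closedV (nsubgroup_closed N)); exact: repr_proj.
Qed.

Lemma quotient_proj_surj (a : quotient_group) : exists x, a = quotient_proj x.
Proof. by exists (repr a); rewrite /quotient_proj reprK. Qed.

Lemma quotient_mulA : associative quotient_mul.
Proof.
move=> a b c; case: (quotient_proj_surj a) => x ->.
case: (quotient_proj_surj b) => y ->; case: (quotient_proj_surj c) => z ->.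
by rewrite !quotient_mulE mulgA.
Qed.

Lemma quotient_mul1 : left_id (quotient_proj 1) quotient_mul.
Proof.
by move=> a; case: (quotient_proj_surj a) => x ->; rewrite quotient_mulE mul1g.
Qed.

Lemma quotient_mulr1 : right_id (quotient_proj 1) quotient_mul.
Proof.
by move=> a; case: (quotient_proj_surj a) => x ->; rewrite quotient_mulE mulg1.
Qed.

Lemma quotient_mulV : left_inverse (quotient_proj 1) quotient_inv quotient_mul.
Proof.
move=> a; case: (quotient_proj_surj a) => x ->.
by rewrite quotient_invE quotient_mulE mulVg.
Qed.

Lemma quotient_mulrV :
  right_inverse (quotient_proj 1) quotient_inv quotient_mul.
Proof.
move=> a; case: (quotient_proj_surj a) => x ->.
by rewrite quotient_invE quotient_mulE mulgV.
Qed.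

HB.instance Definition _ := isGroup.Build quotient_group
  quotient_mulA quotient_mul1 quotient_mulr1 quotient_mulV quotient_mulrV.

Lemma quotient_proj_is_morphism : monoid_morphism quotient_proj.
Proof. by split=> // x y; rewrite -quotient_mulE. Qed.

HB.instance Definition _ := isUMagmaMorphism.Build G quotient_group
  quotient_proj quotient_proj_is_morphism.

End QuotientGroup.

(* The letter (i, false) is the i-th generator, (i, true) is its inverse. *)
Definition word (n : nat) := seq ('I_n * bool).

Inductive free_eq (n : nat) : word n -> word n -> Prop :=
| free_eq_refl u : free_eq u u
| free_eq_sym u v : free_eq u v -> free_eq v u
| free_eq_trans v u w : free_eq u v -> free_eq v w -> free_eq u w
| free_eq_cancel u v i b : free_eq (u ++ (i, b) :: (i, ~~ b) :: v) (u ++ v).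

Section FreeGroup.
Variable n : nat.
Implicit Types u v w : word n.

Definition free_eqb u v : bool := `[< free_eq u v >].

Lemma free_eqb_refl : reflexive free_eqb.
Proof. by move=> u; apply/asboolP/free_eq_refl. Qed.

Lemma free_eqb_sym : symmetric free_eqb.
Proof. by move=> u v; apply/asboolP/asboolP; apply: free_eq_sym. Qed.

Lemma free_eqb_trans : transitive free_eqb.
Proof.
by move=> v u w /asboolP uv /asboolP vw; apply/asboolP/(free_eq_trans uv vw).
Qed.

Canonical free_equiv :=
  EquivRel free_eqb free_eqb_refl free_eqb_sym free_eqb_trans.

Definition free_group := {eq_quot free_equiv}.
HB.instance Definition _ := Choice.on free_group.
HB.instance Definition _ := EqQuotient.on free_group.

Definition free_class u : free_group := \pi_free_group u.

Lemma free_classP u v : free_class u = free_class v <-> free_eq u v.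
Proof.
split=> [e|e]; first by apply/asboolP; apply/(eqmodP free_equiv).
by apply/(eqmodP free_equiv)/asboolP.
Qed.

Lemma free_eq_cat u u' v v' :
  free_eq u u' -> free_eq v v' -> free_eq (u ++ v) (u' ++ v').
Proof.
move=> uu' vv'; apply: (@free_eq_trans _ (u' ++ v)).
  elim: uu' => {vv' v'} [w|w w' _|w1 w w2 _ e1 _ e2|w w' i b].
  - exact: free_eq_refl.
  - exact: free_eq_sym.
  - exact: free_eq_trans e1 e2.
  - by rewrite -!catA /=; apply: free_eq_cancel.
elim: vv' => [w|w w' _|w1 w w2 _ e1 _ e2|w w' i b].
- exact: free_eq_refl.
- exact: free_eq_sym.
- exact: free_eq_trans e1 e2.
- by rewrite !catA; apply: free_eq_cancel.
Qed.

Definition word_inv u : word n := rev [seq (l.1, ~~ l.2) | l <- u].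

Lemma word_inv_cat u v : word_inv (u ++ v) = word_inv v ++ word_inv u.
Proof. by rewrite /word_inv map_cat rev_cat. Qed.

Lemma word_invK : involutive word_inv.
Proof.
move=> u; rewrite /word_inv map_rev revK -map_comp -[RHS]map_id.
by apply: eq_map => -[i b] /=; rewrite negbK.
Qed.

Lemma free_eq_inv u v : free_eq u v -> free_eq (word_inv u) (word_inv v).
Proof.
elim=> {u v} [w|w w' _|w1 w w2 _ e1 _ e2|w w' i b].
- exact: free_eq_refl.
- exact: free_eq_sym.
- exact: free_eq_trans e1 e2.
- rewrite -[_ :: _]/([:: (i, b); (i, ~~ b)] ++ w') !word_inv_cat -catA.
  by rewrite {2}/word_inv /rev /= negbK; have := free_eq_cancel
       (word_inv w') (word_inv w) i b.
Qed.

Lemma free_eq_mulV u : free_eq (u ++ word_inv u) [::].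
Proof.
elim/last_ind: u => [|u [i b] IHu]; first exact: free_eq_refl.
rewrite -cats1 word_inv_cat -catA.
exact: free_eq_trans (free_eq_cancel _ _ _ _) IHu.
Qed.

Definition free_mul (a b : free_group) := free_class (repr a ++ repr b).
Definition free_inv (a : free_group) := free_class (word_inv (repr a)).

Lemma free_eq_repr u : free_eq (repr (free_class u)) u.
Proof. by apply/free_classP; rewrite /free_class reprK. Qed.

Lemma free_mulE u v :
  free_mul (free_class u) (free_class v) = free_class (u ++ v).
Proof. by apply/free_classP/free_eq_cat; apply: free_eq_repr. Qed.

Lemma free_invE u : free_inv (free_class u) = free_class (word_inv u).
Proof. by apply/free_classP/free_eq_inv/free_eq_repr. Qed.

Lemma free_class_surj (a : free_group) : exists u, a = free_class u.
Proof. by exists (repr a); rewrite /free_class reprK. Qed.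

Lemma free_mulA : associative free_mul.
Proof.
move=> a b c; case: (free_class_surj a) => u ->.
case: (free_class_surj b) => v ->; case: (free_class_surj c) => w ->.
by rewrite !free_mulE catA.
Qed.

Lemma free_mul1 : left_id (free_class [::]) free_mul.
Proof. by move=> a; case: (free_class_surj a) => u ->; rewrite free_mulE. Qed.

Lemma free_mulr1 : right_id (free_class [::]) free_mul.
Proof.
by move=> a; case: (free_class_surj a) => u ->; rewrite free_mulE cats0.
Qed.

Lemma free_mulV : left_inverse (free_class [::]) free_inv free_mul.
Proof.
move=> a; case: (free_class_surj a) => u ->.
rewrite free_invE free_mulE; apply/free_classP.
by rewrite -{2}[u]word_invK; apply: free_eq_mulV.
Qed.

Lemma free_mulrV : right_inverse (free_class [::]) free_inv free_mul.
Proof.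
move=> a; case: (free_class_surj a) => u ->.
by rewrite free_invE free_mulE; apply/free_classP/free_eq_mulV.
Qed.

HB.instance Definition _ := isGroup.Build free_group
  free_mulA free_mul1 free_mulr1 free_mulV free_mulrV.

End FreeGroup.

Section NormalClosure.
Variables (G : groupType) (R : seq G).

Definition normal_closure_pred : {pred G} :=
  [pred x | `[< forall N : normal_subgroup G, {subset R <= N} -> x \in N >]].

Lemma normal_closure_group : group_closed normal_closure_pred.
Proof.
split; first by apply/asboolP=> N _; apply: (nsubgroup_closed N).1.
move=> x y /asboolP xR /asboolP yR; apply/asboolP=> N RN.
by apply: (nsubgroup_closed N).2; [apply: xR | apply: yR].
Qed.

Lemma normal_closure_conjg x y :
  x \in normal_closure_pred -> x ^ y \in normal_closure_pred.
Proof.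
by move=> /asboolP xR; apply/asboolP=> N RN; apply/nsubgroup_conjg/xR.
Qed.

Definition normal_closure : normal_subgroup G :=
  NormalSubgroup normal_closure_group normal_closure_conjg.

End NormalClosure.

Definition presented_group (n : nat) (R : seq (free_group n)) : groupType :=
  quotient_group (normal_closure R).

Definition finitely_presented (G : groupType) : Prop :=
  exists (n : nat) (R : seq (free_group n)), isomorphic (presented_group R) G.

Section FiniteResidual.
Variable G : groupType.

Definition finite_residual_pred : {pred G} :=
  [pred x | `[< forall (F : finGroupType) (phi : {ghom G -> F}),
                  surjective phi -> phi x = 1 >]].

Lemma finite_residual_group : group_closed finite_residual_pred.
Proof.
split; first by apply/asboolP=> F phi _; rewrite gmulf1.
move=> x y /asboolP x1 /asboolP y1; apply/asboolP=> F phi sphi.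
by rewrite gmulfF (x1 F) // (y1 F) // divg1.
Qed.

Lemma finite_residual_conjg x y :
  x \in finite_residual_pred -> x ^ y \in finite_residual_pred.
Proof.
move=> /asboolP x1; apply/asboolP=> F phi sphi.
by rewrite gmulfJ (x1 F) // conj1g.
Qed.

Definition finite_residual : normal_subgroup G :=
  NormalSubgroup finite_residual_group finite_residual_conjg.

Definition rf_image : groupType := quotient_group finite_residual.
Definition rf_proj : {ghom G -> rf_image} := quotient_proj finite_residual.

End FiniteResidual.

(* Residual finiteness of L is not a separate clause: it follows from L being
   isomorphic to a residually finite image. *)
Definition rf_finitely_presented_marked
    (L : groupType) (n : nat) (S : n.-tuple L) : Prop :=
  exists (G : groupType) (T : n.-tuple G),
    [/\ finitely_presented G, generates T
      & exists2 f : {ghom rf_image G -> L}, bijective f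
          & map_tuple (f \o rf_proj G) T = S].

Definition rf_finitely_presented (L : groupType) : Prop :=
  exists (n : nat) (S : n.-tuple L),
    generates S /\ rf_finitely_presented_marked S.

(* A wr B is the semidirect product of B with the group of finitely supported
   functions B -> A, on which B acts by (b . f)(x) = f (b^-1 x). *)
Section Wreath.
Variables A B : groupType.

Definition lamps := {fsfun B -> A with 1}.
Implicit Types (f g h : lamps) (b c x : B).

Definition lamps_mul f g : lamps :=
  [fsfun x in (finsupp f `|` finsupp g)%fset => f x * g x | 1].
Definition lamps_inv f : lamps := [fsfun x in finsupp f => (f x)^-1 | 1].
Definition lamps_act b f : lamps :=
  [fsfun x in [fset b * y | y in finsupp f]%fset => f (b^-1 * x) | 1].

Lemma lamps_mulE f g x : lamps_mul f g x = f x * g x.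
Proof.
rewrite fsfunE inE; case: ifPn => //; rewrite negb_or => /andP[fx gx].
by rewrite !fsfun_dflt // mulg1.
Qed.

Lemma lamps_invE f x : lamps_inv f x = (f x)^-1.
Proof. by rewrite fsfunE; case: finsuppP; rewrite // invg1. Qed.

Lemma lamps_actE b f x : lamps_act b f x = f (b^-1 * x).
Proof.
rewrite fsfunE; case: ifPn => // bx; case: finsuppP => // fx; case/negP: bx.
by apply/imfsetP; exists (b^-1 * x); rewrite ?mulKVg.
Qed.

Definition wreath : Type := (lamps * B)%type.
HB.instance Definition _ := Choice.on wreath.

Definition wreath_mul (p q : wreath) : wreath :=
  (lamps_mul p.1 (lamps_act p.2 q.1), p.2 * q.2).
Definition wreath_one : wreath := ([fsfun for fun=> 1], 1).
Definition wreath_inv (p : wreath) : wreath :=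
  (lamps_act p.2^-1 (lamps_inv p.1), p.2^-1).

Let lampsE := (lamps_mulE, lamps_actE, lamps_invE, fsfun0E).

Lemma wreath_mulA : associative wreath_mul.
Proof.
move=> p q r; congr (_, _); last exact: mulgA.
by apply/fsfunP=> x; rewrite !lampsE invgM !mulgA.
Qed.

Lemma wreath_mul1 : left_id wreath_one wreath_mul.
Proof.
case=> f b; congr (_, _); last exact: mul1g.
by apply/fsfunP=> x; rewrite !lampsE invg1 !mul1g.
Qed.

Lemma wreath_mulr1 : right_id wreath_one wreath_mul.
Proof.
case=> f b; congr (_, _); last exact: mulg1.
by apply/fsfunP=> x; rewrite !lampsE mulg1.
Qed.

Lemma wreath_mulV : left_inverse wreath_one wreath_inv wreath_mul.
Proof.
case=> f b; congr (_, _); last exact: mulVg.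
by apply/fsfunP=> x; rewrite !lampsE /= mulVg.
Qed.

Lemma wreath_mulrV : right_inverse wreath_one wreath_inv wreath_mul.
Proof.
case=> f b; congr (_, _); last exact: mulgV.
by apply/fsfunP=> x; rewrite !lampsE /= invgK mulKVg mulgV.
Qed.

HB.instance Definition _ := isGroup.Build wreath
  wreath_mulA wreath_mul1 wreath_mulr1 wreath_mulV wreath_mulrV.

End Wreath.

Definition lamplighter : groupType :=
  wreath (Algebra.to_multiplicative 'Z_2) (Algebra.to_multiplicative int).

(* Main.v *)
(* If the lamplighter group L is the residually finite image of a finitely
   presented group G, then every homomorphism from G to a finite group factors
   through L.  Take finite groups P_k and maps sigma_k : L -> P_k such that each
   given product in L is preserved by sigma_k for large k.  Sending the
   generators of G to their images under L -> P_k respects the finitely many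
   relators once k is large, so it defines a homomorphism L -> P_k that agrees
   with sigma_k on the two standard generators.  In L all conjugates of the
   lamp a by powers of the shift t commute.  In P_k the conjugates of a are
   indexed by Z/(2k+3), and a fails to commute with its conjugate by t^(k+1),
   which moves further and further away from a as k grows. *)

Require Import Defs.
From HB Require Import structures.
From mathcomp Require Import all_boot all_algebra all_fingroup.
From mathcomp Require Import finmap boolp classical_sets filter.
From mathcomp Require Import generic_quotient zify ring.

Set Implicit Arguments.
Unset Strict Implicit.
Unset Printing Implicit Defensive.

Import GRing.Theory.
Local Open Scope classical_set_scope.
Local Open Scope group_scope.

(** * Homomorphisms, free groups and presentations *)

Lemma ghomP (G H : groupType) (f : G -> H) :
  {morph f : x y / x * y} -> exists g : {ghom G -> H}, g =1 f.
Proof.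
move=> fM; have f1 : f 1 = 1 by apply: (mulgI (f 1)); rewrite -fM !mulg1.
pose fH := isUMagmaMorphism.Build G H f (f1, fM).
by exists (HB.pack_for {ghom G -> H} f fH).
Qed.

(** [h] is constant on the fibres of [p], so its value at a chosen preimage does not depend on the
    choice. *)
Lemma ghom_factor (A B C : groupType) (p : {ghom A -> B}) (h : {ghom A -> C}) :
    surjective p -> (forall a, p a = 1 -> h a = 1) ->
  exists g : {ghom B -> C}, forall a, g (p a) = h a.
Proof.
move=> sp kph; pose s b := sval (cid (sp b)).
have sK b : p (s b) = b by rewrite /s; case: cid.
have hs a a' : p a = p a' -> h a = h a'.
  by move=> e; apply/divg1_eq; rewrite -gmulfF kph // gmulfF e divgg.
have [|g gE] := @ghomP B C (fun b => h (s b)).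
  by move=> b b'; rewrite -gmulfM; apply: hs; rewrite gmulfM !sK.
by exists g => a; rewrite gE; apply: hs; rewrite sK.
Qed.

Section FreeLift.
Variables (n : nat) (H : groupType) (s : 'I_n -> H).

Definition letter_eval (l : 'I_n * bool) : H :=
  if l.2 then (s l.1)^-1 else s l.1.

Definition word_eval (w : word n) : H := \prod_(l <- w) letter_eval l.

Lemma word_eval_cat u v : word_eval (u ++ v) = word_eval u * word_eval v.
Proof. exact: big_cat. Qed.

Lemma word_eval_free_eq u v : free_eq u v -> word_eval u = word_eval v.
Proof.
elim=> {u v} // [u v w _ -> _ ->|u v i b] //.
rewrite !word_eval_cat; congr (_ * _).
rewrite /word_eval !big_cons mulgA /letter_eval.
by case: b; rewrite /= ?mulVg ?mulgV mul1g.
Qed.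

Lemma free_lift : exists h : {ghom free_group n -> H},
  forall w, h (free_class w) = word_eval w.
Proof.
have reprE w : word_eval (repr (free_class w)) = word_eval w.
  exact/word_eval_free_eq/free_eq_repr.
have [|h hE] := @ghomP (free_group n) H (fun a => word_eval (repr a)).
  move=> a b; have [u ->] := free_class_surj a; have [v ->] := free_class_surj b.
  by rewrite -[_ * _]/(free_mul _ _) free_mulE !reprE word_eval_cat.
by exists h => w; rewrite hE reprE.
Qed.

End FreeLift.

Lemma normal_closure_ker (G H : groupType) (R : seq G) (h : {ghom G -> H}) :
  {in R, forall r, h r = 1} -> {in normal_closure R, forall x, h x = 1}.
Proof.
move=> hR x /asboolP; pose K : {pred G} := [pred x | h x == 1].
have Kgroup : group_closed K.
  split=> [|y z]; rewrite !inE ?gmulf1 // => /eqP hy /eqP hz.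
  by rewrite gmulfF hy hz divgg.
have Kconj y z : y \in K -> y ^ z \in K.
  by rewrite !inE gmulfJ => /eqP ->; rewrite conj1g.
move=> /(_ (NormalSubgroup Kgroup Kconj)) xK.
by apply/eqP/xK => r Rr; rewrite inE hR.
Qed.

Lemma quotient_proj_eq1 (G : groupType) (N : normal_subgroup G) x :
  quotient_proj N x = 1 <-> x \in N.
Proof.
have E : (x \in N) = (1^-1 * x \in N) by rewrite invg1 mul1g.
rewrite E -(gmulf1 (s:=quotient_proj N)).
by split=> [/esym/quotient_projP|/quotient_projP].
Qed.

(** Serves to get a single threshold for the finitely many relators. *)
Lemma near_seq (T : choiceType) (s : seq T) (Q : nat -> T -> Prop) :
    {in s, forall x, \forall k \near \oo, Q k x} ->
  \forall k \near \oo, {in s, forall x, Q k x}.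
Proof.
elim: s => [|x s IHs] sQ; first by apply: nearW.
have Qs : \forall k \near \oo, {in s, forall x, Q k x}.
  by apply: IHs => y ys; apply: sQ; rewrite inE ys orbT.
apply: filterS2 (sQ x (mem_head _ _)) Qs => k Qx Qs y.
by rewrite inE => /predU1P[->|/Qs].
Qed.

Lemma finitely_presentedP (G : groupType) : finitely_presented G ->
  exists n (R : seq (free_group n)) (p : {ghom free_group n -> G}),
    surjective p /\ forall a, p a = 1 <-> a \in normal_closure R.
Proof.
move=> [n [R [f [g fK gK]]]].
exists n, R, (f \o quotient_proj (normal_closure R) : {ghom _ -> _}); split.
  move=> x; have [a ga] := quotient_proj_surj (g x).
  by exists a; rewrite /= -ga gK.
move=> a /=; rewrite -(gmulf1 (s:=f)) -(quotient_proj_eq1 (normal_closure R)).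
by split=> [/(can_inj fK)|->].
Qed.

(** The residual is cut out by surjections, so [h] is replaced by its corestriction to its image, a
    subgroup of [F] and hence finite. *)
Lemma finite_residual_ker (G : groupType) (F : finGroupType)
    (h : {ghom G -> F}) : {in finite_residual G, forall x, h x = 1}.
Proof.
pose A := [set y : F | `[< exists x, h x = y >]]%SET.
have inA x : h x \in A by rewrite inE; apply/asboolP; exists x.
have Aim y : y \in A -> exists x, h x = y by rewrite inE => /asboolP.
have gA : group_set A.
  apply/group_setP; split=> [|y z]; first by rewrite -(gmulf1 (s:=h)).
  by move=> /Aim[y' <-] /Aim[z' <-]; rewrite -gmulfM inA.
pose H := Group gA.
have [|g gE] := @ghomP G (subg_of H) (fun x => subg H (h x)).
  by move=> x y; rewrite gmulfM subgM /= ?inA.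
move=> x /asboolP /(_ _ g) gx.
rewrite -(@subgK _ H (h x)) ?inA // -gE gx // => y.
have [z hz] := Aim _ (subgP y); exists z.
by rewrite gE hz sgvalK.
Qed.

(** * From approximate to exact homomorphisms *)

Lemma rf_finitely_presented_approx (L : groupType) (P : nat -> finGroupType)
    (sigma : forall k, L -> P k) :
    (forall x y, \forall k \near \oo,
       sigma k (x * y) = sigma k x * sigma k y) ->
    rf_finitely_presented L ->
  forall x y, \forall k \near \oo, exists psi : {ghom L -> P k},
    psi x = sigma k x /\ psi y = sigma k y.
Proof.
move=> sM [m [S [_ [G [T [fpG _ [f [f' fK f'K] _]]]]]]].
have [n [R [p [sp kp]]]] := finitely_presentedP fpG.
pose q : {ghom free_group n -> L} := f \o (rf_proj G \o p).
have sq x : exists w, q (free_class w) = x.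
  have [g gx] := quotient_proj_surj (f' x); have [a pa] := sp g.
  have [w aw] := free_class_surj a.
  by exists w; rewrite -aw /= pa -[rf_proj G g]gx f'K.
have s1 : \forall k \near \oo, sigma k 1 = 1.
  apply: filterS (sM 1 1) => k; rewrite mulg1 => e.
  by apply: (mulgI (sigma k 1)); rewrite mulg1.
have sV x : \forall k \near \oo, sigma k x^-1 = (sigma k x)^-1.
  apply: filterS2 s1 (sM x x^-1) => k e1; rewrite mulgV e1 => e.
  by apply: (mulgI (sigma k x)); rewrite mulgV.
(* [sigma k] need not be multiplicative, so only its values on the generators are kept; evaluating
   words in [s k] is multiplicative for every [k]. *)
pose s k i := sigma k (q (free_class [:: (i, false)])).
have sE w : \forall k \near \oo, word_eval (s k) w = sigma k (q (free_class w)).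
  elim: w => [|[i b] w IHw].
    apply: filterS s1 => k e; rewrite /word_eval big_nil.
    by rewrite (gmulf1 (s:=q) : q (free_class [::]) = 1) e.
  have consE : free_class ((i, b) :: w)
      = free_class [:: (i, b)] * free_class w :> free_group n.
    by rewrite -[RHS]/(free_mul _ _) free_mulE.
  have lE : \forall k \near \oo,
      letter_eval (s k) (i, b) = sigma k (q (free_class [:: (i, b)])).
    case: b {consE}; last by apply: nearW.
    have -> : free_class [:: (i, true)] = (free_class [:: (i, false)])^-1
        :> free_group n by rewrite -[RHS]/(free_inv _) free_invE.
    by rewrite gmulfV; apply: filterS (sV (q (free_class [:: (i, false)]))) => k ->.
  rewrite consE gmulfM; near=> k.
  have -> : sigma k (q (free_class [:: (i, b)]) * q (free_class w)) =
    sigma k (q (free_class [:: (i, b)])) * sigma k (q (free_class w)).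
    by near: k; apply: sM.
  rewrite /word_eval big_cons; congr (_ * _); near: k; [exact: lE | exact: IHw].
have sR : \forall k \near \oo, {in R, forall r, word_eval (s k) (repr r) = 1}.
  apply: near_seq => r Rr; apply: filterS2 s1 (sE (repr r)) => k e1 ->.
  rewrite /free_class reprK /q /=.
  have -> : p r = 1 by apply/kp/asboolP => N; apply.
  by rewrite !gmulf1.
move=> x y; have [u ux] := sq x; have [v vy] := sq y.
near=> k.
(* [h] kills the relators, so it descends to [h1] on [G]; as [P k] is finite, [h1] kills the finite
   residual and descends to [psi] on [L]. *)
have [h hE] := free_lift (s k).
have [|h1 h1E] := @ghom_factor _ _ _ p h sp.
  move=> a /kp; apply: normal_closure_ker a => r Rr.
  have -> : r = free_class (repr r) by rewrite /free_class reprK.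
  rewrite hE.
  by move: r Rr; near: k.
have sf : surjective (f \o rf_proj G).
  move=> z; have [g gx] := quotient_proj_surj (f' z).
  by exists g; rewrite /= -[rf_proj G g]gx f'K.
have [|psi psiE] := @ghom_factor _ _ _ (f \o rf_proj G : {ghom _ -> _}) h1 sf.
  move=> g; rewrite -(gmulf1 (s:=f)) => /(can_inj fK) /quotient_proj_eq1.
  exact: finite_residual_ker.
exists psi; rewrite -ux -vy !psiE !h1E !hE; split; near: k; exact: sE.
Unshelve. all: by end_near.
Qed.

(* A class-2 nilpotent modification of the wreath product of Z/2 by I: lamps
   carry a central Z/2-valued configuration, recording with the cocycle
   f(i) g(i + d) the failure of lamps at distance d to commute. *)
Definition twisted_lamps (I : finZmodType) & I : Type :=
  ({ffun I -> 'Z_2} * {ffun I -> 'Z_2} * I)%type.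

Section TwistedLamps.
Local Open Scope ring_scope.
Variables (I : finZmodType) (d : I).

Local Notation twisted := (twisted_lamps d).
HB.instance Definition _ := Finite.on twisted.
Implicit Types x y z : twisted.

Definition twisted_mul x y : twisted :=
  ([ffun i => x.1.1 i + y.1.1 (i - x.2)],
   [ffun i => x.1.2 i + y.1.2 (i - x.2) + x.1.1 i * y.1.1 (i + d - x.2)],
   x.2 + y.2).

Definition twisted_one : twisted := ([ffun=> 0], [ffun=> 0], 0).

Definition twisted_inv x : twisted :=
  ([ffun i => - x.1.1 (i + x.2)],
   [ffun i => x.1.1 (i + x.2) * x.1.1 (i + d + x.2) - x.1.2 (i + x.2)],
   - x.2).

Lemma twisted_mulA : associative twisted_mul.
Proof.
move=> x y z; congr (_, _, _); last exact: addrA.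
  by apply/ffunP => i; rewrite !ffunE /= opprD !addrA.
apply/ffunP => i; rewrite !ffunE /= opprD !addrA (addrAC i (- x.2) d).
ring.
Qed.

Lemma twisted_mul1 : left_id twisted_one twisted_mul.
Proof.
move=> [[f c] n]; congr (_, _, _); last exact: add0r.
  by apply/ffunP => i; rewrite !ffunE /= subr0 add0r.
by apply/ffunP => i; rewrite !ffunE /= subr0 add0r mul0r addr0.
Qed.

Lemma twisted_mulV : left_inverse twisted_one twisted_inv twisted_mul.
Proof.
move=> x; congr (_, _, _); last exact: addNr.
  by apply/ffunP => i; rewrite !ffunE /= opprK addNr.
apply/ffunP => i; rewrite !ffunE /= opprK.
ring.
Qed.

HB.instance Definition _ :=
  Finite_isGroup.Build twisted twisted_mulA twisted_mul1 twisted_mulV.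

Definition twisted_lamp : twisted := ([ffun i => (i == 0)%:R], [ffun=> 0], 0).
Definition twisted_shift (n : I) : twisted := ([ffun=> 0], [ffun=> 0], n).

Lemma twisted_shiftX n j : (twisted_shift n ^+ j)%g = twisted_shift (n *+ j).
Proof.
elim: j => [|j IHj] //; rewrite expgS IHj; congr (_, _, _); last by rewrite mulrS.
  by apply/ffunP => i; rewrite !ffunE addr0.
by apply/ffunP => i; rewrite !ffunE /= mul0r !addr0.
Qed.

(** The second lamp sits at [d]. At position 0 the central coordinate is 1 for the product in the
    given order, and 0 in the other order because [d] is nonzero. *)
Lemma twisted_noncommuting : d != 0 ->
  ~ commute twisted_lamp (twisted_lamp ^ (twisted_shift d)^-1)%g.
Proof.
move=> d0 /(congr1 (fun x : twisted => x.1.2 0)).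
have E (x y : twisted) : (x * y)%g = twisted_mul x y by [].
have EV (x : twisted) : (x^-1)%g = twisted_inv x by [].
rewrite /conjg invgK !E EV; do ?rewrite !ffunE /=.
rewrite !(addr0, add0r, oppr0, subr0, mul0r, mulr0, subrr) eqxx.
by rewrite oppr_eq0 (negPf d0) mulr0 mulr1 => /eqP; rewrite oner_eq0.
Qed.

End TwistedLamps.

(** * Approximating the lamplighter group by finite twisted groups *)

Section Approximation.
Local Open Scope ring_scope.

Section CyclicWindow.
Variable k : nat.
Local Notation Zm := 'Z_(k.*2.+3).

(* The representative in [-(k+1), k+1]. *)
Definition window_lift (i : Zm) : int :=
  if (i <= k.+1)%N then (i : nat)%:Z else (i : nat)%:Z - k.*2.+3%:Z.

Lemma window_lift_le i : (`|window_lift i| <= k.+1)%N.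
Proof.
by rewrite /window_lift; have := ltn_ord i; rewrite /Zp_trunc /=; case: ifP; lia.
Qed.

Lemma window_liftK i : (window_lift i)%:~R = i.
Proof.
have m0 : (k.*2.+3%:Z)%:~R = 0 :> Zm by exact: char_Zp.
rewrite /window_lift; case: ifP => _; rewrite ?rmorphB /= ?m0 ?subr0;
  exact: natr_Zp.
Qed.

Lemma intr_window_inj (x y : int) : (`|x - y| < k.*2.+3)%N ->
  x%:~R = y%:~R :> Zm -> x = y.
Proof.
wlog le_yx : x y / y <= x.
  move=> W xy e; have [h|h] : y <= x \/ x <= y by lia.
    exact: W.
  by apply/esym/W => //; lia.
have [j xyj] : exists j : nat, x - y = j%:Z by exists `|x - y|%N; lia.
move=> jm /eqP; rewrite -subr_eq0 -rmorphB /= xyj -pmulrn => /eqP.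
move=> /(congr1 (@nat_of_ord _)); rewrite val_Zp_nat // modn_small /=; lia.
Qed.

Lemma window_liftP x : (`|x| <= k.+1)%N -> window_lift x%:~R = x.
Proof.
move=> xk; apply: intr_window_inj; last exact: window_liftK.
have := window_lift_le x%:~R; lia.
Qed.

End CyclicWindow.


(** In Z/(2k+3) the residue k+1 is as far from 0 as possible: k+1 steps one way, k+2 the other. *)
Definition approx_group (k : nat) : finGroupType :=
  @twisted_lamps 'Z_(k.*2.+3) k.+1%:R.

Definition approx (k : nat) (x : lamplighter) : approx_group k :=
  ([ffun i => x.1 (window_lift i)], [ffun=> 0], (x.2 : int)%:~R).

Lemma lamps_bounded (f : lamps (Algebra.to_multiplicative 'Z_2)
    (Algebra.to_multiplicative int)) :
  exists N, forall x : int, (N < `|x|)%N -> f x = 0 :> 'Z_2.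
Proof.
exists (\max_(x <- finsupp f) `|(x : int)|)%N => x Nx.
apply: fsfun_dflt; apply/negP => fx; move: Nx.
by rewrite ltnNge (leq_bigmax_seq _ fx).
Qed.

Lemma approxM (x y : lamplighter) :
  \forall k \near \oo, approx k (x * y)%g = (approx k x * approx k y)%g.
Proof.
case: x y => [f n] [g p].
have [Nf fN] := lamps_bounded f; have [Ng gN] := lamps_bounded g.
(* Beyond this threshold the integers compared below differ by less than 2k+3, so their congruences
   become equalities. *)
exists (Nf + Ng + `|(n : int)|)%N => // k /= Kk.
(* Wrapping is invisible to [g]: if [u] leaves the window, [g] vanishes there; a lamp at the wrapped
   position would make that position equal to [u], hence inside the window. *)
have shift_g (i : 'Z_(k.*2.+3)) :
    g (window_lift i - (n : int)) = g (window_lift (i - (n : int)%:~R)).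
  set u := window_lift i - (n : int).
  have uE : i - (n : int)%:~R = u%:~R by rewrite rmorphB /= window_liftK.
  case: (leqP `|u| k.+1) => uk; first by rewrite uE window_liftP.
  rewrite gN; last by lia.
  case: (leqP `|window_lift (i - (n : int)%:~R)| Ng) => [vN|/gN-> //].
  have : window_lift i = window_lift (i - (n : int)%:~R) + (n : int).
    apply: (@intr_window_inj k); last by rewrite rmorphD /= !window_liftK subrK.
    have := window_lift_le i; lia.
  lia.
congr (_, _, _).
- apply/ffunP => i; rewrite !ffunE /= lamps_mulE lamps_actE -shift_g.
  by congr (_ + g _); apply: addrC.
- apply/ffunP => i; rewrite !ffunE /= !add0r.
  (* A nonzero cocycle term would give k+1 = n - a + b, with a and b the lifts of [i] and [j]; but
     the right side is at most [Nf + Ng + |n|], hence at most k. *)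
  case: (leqP `|window_lift i| Nf) => [fi|/fN ->]; last by rewrite mul0r.
  set j := i + _ - _.
  case: (leqP `|window_lift j| Ng) => [gj|/gN ->]; last by rewrite mulr0.
  have : window_lift i - window_lift j + k.+1%:Z - (n : int) = 0.
    apply: (@intr_window_inj k); first by lia.
    rewrite rmorphB rmorphD rmorphB /= !window_liftK /j.
    by rewrite opprB -pmulrn; ring.
  lia.
- exact: rmorphD.
Qed.

End Approximation.

(** * The standard generators and the contradiction *)

Definition lamp : lamplighter :=
  ([fsfun x in [fset (0%R : int)]%fset => (1%R : 'Z_2) | 1], 1).

Definition walk : lamplighter := ([fsfun for fun=> 1], 1%R : int).

Lemma approx_lamp k : approx k lamp = twisted_lamp _.
Proof.
congr (_, _, _); apply/ffunP => i; rewrite !ffunE /= fsfunE inE.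
have -> : (window_lift i == 0%R) = (i == 0%R); last by case: (i == 0%R).
apply/eqP/eqP => [i0|->]; first by rewrite -[i]window_liftK i0.
exact: (@window_liftP k 0).
Qed.

Lemma approx_walk k : approx k walk = twisted_shift _ 1%R.
Proof. by congr (_, _, _); apply/ffunP => i; rewrite !ffunE /= fsfun0E. Qed.

Lemma lamplighter_base_commute (x y : lamplighter) :
  x.2 = 1 -> y.2 = 1 -> commute x y.
Proof.
case: x y => [f n] [g p] /= -> ->; congr (_, _).
apply/fsfunP => i; rewrite !lamps_mulE !lamps_actE invg1 !mul1g.
exact: addrC.
Qed.

Lemma lamplighter_baseJ (x y : lamplighter) : x.2 = 1 -> (x ^ y).2 = 1.
Proof. by move=> x1; rewrite /conjg /= x1 mul1g mulVg. Qed.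

Theorem proposition55 : ~ rf_finitely_presented lamplighter.
Proof.
move=> /(rf_finitely_presented_approx approxM) /(_ lamp walk) [k _].
move=> /(_ k (leqnn k)) [psi [psi_lamp psi_walk]].
(* The exponent k+1 makes the conjugating element map to the shift by exactly the twisting distance
   of [approx_group k]. *)
have : commute (psi lamp) (psi lamp ^ (psi walk ^+ k.+1)^-1).
  rewrite -gmulfXn -gmulfV -gmulfJ; apply/gmulf_commute.
  by apply: lamplighter_base_commute => //; apply: lamplighter_baseJ.
rewrite psi_lamp psi_walk approx_lamp approx_walk twisted_shiftX.
apply: twisted_noncommuting; apply/eqP => /(congr1 (@nat_of_ord _)).
by rewrite val_Zp_nat // modn_small //; lia.
Qed.
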